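(* Let $n \geq 1$, let $K \subset \mathbb{R}^n$ be a compact convex body with smooth boundary and let $L \subset \mathbb{R}^n$ be a lattice of full rank that is well-rounded. Then there exist a set $S \subset L$ with $|S| = n+1$ and a translated copy $K' = K + v$ of $K$ (for some $v \in \mathbb{R}^n$) such that $S$ illuminates $K'$ and $$d(S,K') \leq 2 \left[ \frac{2^n C_n D(K)}{\omega_n \|L\|} + 1 \right] \|L\|,$$ where $[\ ]$ denotes the integer part, $\omega_n$ is the volume of a unit ball in $\mathbb{R}^n$, and $$C_n = \frac{ n \sqrt{n} \left( n+2^{n-1} \right)}{\sqrt{2(n+1)}}.$$
   Context: $\|\cdot\|$ is the Euclidean norm on $\mathbb{R}^n$. A compact convex body is a compact convex subset of $\mathbb{R}^n$ with nonempty interior; $\partial K$ is its boundary and $\mathrm{int}(K)$ its interior. $K$ has smooth boundary if there is a unique support hyperplane to $K$ at each point of $\partial K$. A point $x \in \mathbb{R}^n$ illuminates a point $y \in \partial K$ (with $x \neq y$) if the line segment connecting $x$ and $y$ does not intersect $\mathrm{int}(K)$, but the line containing this segment intersects $\mathrm{int}(K)$. A set $S \subset \mathbb{R}^n$ illuminates $K$ if every $y \in \partial K$ is illuminated by some $x \in S$. For a finite set $S$ that illuminates $K$, the illumination distance is $d(S,K) = \max\{\|x-y\| : x \in S,\ y \in K\}$. The diameter of $K$ is $D(K) = \max\{\|x-y\| : x,y \in K\}$ (invariant under translation). Convention of the source: translated copies of $K$ are identified with $K$, so illuminating $K$ means illuminating some translated copy of $K$; this is written out explicitly in the claim. For a full-rank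 lattice $L \subset \mathbb{R}^n$, $\|L\| = \min\{\|x\| : x \in L\setminus\{0\}\}$ is its minimal norm. $L$ is well-rounded if it contains $n$ linearly independent vectors of norm $\|L\|$. *)

(* Defs.v *)
From HB Require Import structures.
From mathcomp Require Import all_boot all_order all_algebra.
From mathcomp Require Import all_classical all_reals all_analysis.

Set Implicit Arguments.
Unset Strict Implicit.
Unset Printing Implicit Defensive.

Import Order.TTheory GRing.Theory Num.Theory.
Import numFieldNormedType.Exports.

Local Open Scope classical_set_scope.
Local Open Scope ring_scope.

(* The library norm of 'rV[R]_n is the sup norm, hence [enorm].  The library
   topology is the usual one of R^n, so [compact], [closure] and [interior]
   are the usual notions. *)
Definition dotp (R : realType) (n : nat) (x y : 'rV[R]_n) : R :=
  \sum_(i < n) x 0 i * y 0 i.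

Definition enorm (R : realType) (n : nat) (x : 'rV[R]_n) : R :=
  Num.sqrt (dotp x x).

Definition bdry (R : realType) (n : nat) (K : set 'rV[R]_n) : set 'rV[R]_n :=
  closure K `\` interior K.

Definition convex_body (R : realType) (n : nat) (K : set 'rV[R]_n) : Prop :=
  [/\ compact K, convex_set K & interior K !=set0].

(* A hyperplane is a set of points: the pair (u, c) is only determined up to
   scaling, so uniqueness below is about H. *)
Definition support_hyperplane (R : realType) (n : nat) (K : set 'rV[R]_n)
    (y : 'rV[R]_n) (H : set 'rV[R]_n) : Prop :=
  exists (u : 'rV[R]_n) (c : R),
    [/\ u != 0, H = [set x | dotp u x = c], H y
      & forall x, K x -> dotp u x <= c].

Definition smooth_boundary (R : realType) (n : nat) (K : set 'rV[R]_n) : Prop :=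
  forall y, bdry K y -> exists! H, support_hyperplane K y H.

Definition translate (R : realType) (n : nat) (v : 'rV[R]_n)
    (K : set 'rV[R]_n) : set 'rV[R]_n :=
  [set x + v | x in K].

Definition line (R : realType) (n : nat) (x y : 'rV[R]_n) : set 'rV[R]_n :=
  [set x + t *: (y - x) | t in [set: R]].

Definition segment (R : realType) (n : nat) (x y : 'rV[R]_n) : set 'rV[R]_n :=
  [set x + t *: (y - x) | t in `[0, 1]].

Definition illuminates_point (R : realType) (n : nat) (K : set 'rV[R]_n)
    (x y : 'rV[R]_n) : Prop :=
  [/\ x != y, segment x y `&` interior K = set0
    & line x y `&` interior K !=set0].

Definition illuminates (R : realType) (n : nat) (S K : set 'rV[R]_n) : Prop :=
  forall y, bdry K y -> exists2 x, S x & illuminates_point K x y.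

(* For compact nonempty K and finite nonempty S the suprema in [illum_dist] and
   [diameter] are maxima; for a full-rank lattice of dimension n >= 1 the
   infimum in [min_norm] is a minimum. *)
Definition illum_dist (R : realType) (n : nat) (S K : set 'rV[R]_n) : R :=
  sup [set enorm (x - y) | x in S & y in K].

Definition diameter (R : realType) (n : nat) (K : set 'rV[R]_n) : R :=
  sup [set enorm (x - y) | x in K & y in K].

Definition full_rank_lattice (R : realType) (n : nat) (L : set 'rV[R]_n) : Prop :=
  exists2 B : 'M[R]_n, row_free B &
    L = [set map_mx intr z *m B | z in [set: 'rV[int]_n]].

Definition min_norm (R : realType) (n : nat) (L : set 'rV[R]_n) : R :=
  inf [set enorm x | x in L `\ 0].

Definition well_rounded (R : realType) (n : nat) (L : set 'rV[R]_n) : Prop :=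
  exists2 A : 'M[R]_n, row_free A &
    forall i, L (row i A) /\ enorm (row i A) = min_norm L.

(* The n-dimensional Lebesgue measure, as the n-fold product of the
   one-dimensional one: [volume n.+1] integrates the [volume n] of the sections
   along the first coordinate, which is the definition of the product measure
   [product_measure1]. *)
Fixpoint volume (R : realType) (n : nat) : set 'rV[R]_n -> \bar R :=
  match n with
  | 0 => fun A => (\1_A 0)%:E
  | m.+1 => fun A =>
      (\int[lebesgue_measure]_t
         volume [set x : 'rV[R]_m | A (row_mx t%:M x : 'rV[R]_(1 + m))])%E
  end.

Definition omega (R : realType) (n : nat) : R :=
  fine (volume [set x : 'rV[R]_n | enorm x <= 1]).

Definition Cn (R : realType) (n : nat) : R :=
  n%:R * Num.sqrt n%:R * (n%:R + 2 ^+ n.-1) / Num.sqrt (2 * (n%:R + 1)).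

(* Main.v *)
(* Let a_1, ..., a_n be independent minimal vectors, l their norm, A the matrix
   with rows a_i.  A simplex containing a smooth body in its interior
   illuminates it by its vertices: the support hyperplane at a boundary point y
   leaves some vertex s strictly on its outer side, and if the line through s
   and y missed the interior, a separating hyperplane containing that line
   would be a second support hyperplane at y.

   We take S = {0, k a_1, ..., k a_n}.  If every dual coordinate
   x |-> (x A^-1)_i varies by at most M on K, some translate of K lies in the
   interior of conv S as soon as (2n-1) M < k: relative to a point p of K that
   minimizes the first coordinate, only the other n-1 coordinates need a margin
   M below, while the sum of all n needs a margin n M above.
   Hadamard's inequality bounds the dual vectors by l^(n-1) / |det A|, and
   Minkowski's argument gives |det A| >= omega_n (l/2)^n.  Hence
   M <= 2^n D / (omega_n l), and C_n >= n^2 >= 2n-1 concludes.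

   Minkowski's bound is proved by induction on n, for finite families of balls
   packing modulo Z^n A: after a rotation the lattice has all generators but
   the first in the hyperplane of the last n-1 coordinates, and slicing by the
   first coordinate gives families of balls packing modulo a lattice of rank
   n-1. *)
Require Import Defs.
From mathcomp Require Import all_boot all_order all_algebra.
From mathcomp Require Import all_classical all_reals all_analysis.
From mathcomp Require Import measurable_realfun perm ring lra.

Set Implicit Arguments.
Unset Strict Implicit.
Unset Printing Implicit Defensive.

Import Order.TTheory GRing.Theory Num.Theory.
Import numFieldNormedType.Exports.

Local Open Scope classical_set_scope.
Local Open Scope ring_scope.

(** * Euclidean inner product and norm *)

Lemma dotpE (R : realType) (n : nat) (x y : 'rV[R]_n) :
  dotp x y = (x *m y^T) 0 0.
Proof. by rewrite /dotp mxE; apply: eq_bigr => i _; rewrite mxE. Qed.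

Lemma dotpC (R : realType) (n : nat) (x y : 'rV[R]_n) : dotp x y = dotp y x.
Proof. by apply: eq_bigr => i _; rewrite mulrC. Qed.

Lemma dotpDr (R : realType) (n : nat) (x y z : 'rV[R]_n) :
  dotp x (y + z) = dotp x y + dotp x z.
Proof. by rewrite !dotpE linearD mulmxDr mxE. Qed.

Lemma dotpDl (R : realType) (n : nat) (x y z : 'rV[R]_n) :
  dotp (x + y) z = dotp x z + dotp y z.
Proof. by rewrite !dotpE mulmxDl mxE. Qed.

Lemma dotpZl (R : realType) (n : nat) (a : R) (x y : 'rV[R]_n) :
  dotp (a *: x) y = a * dotp x y.
Proof. by rewrite !dotpE -scalemxAl mxE. Qed.

Lemma dotpZr (R : realType) (n : nat) (a : R) (x y : 'rV[R]_n) :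
  dotp x (a *: y) = a * dotp x y.
Proof. by rewrite dotpC dotpZl dotpC. Qed.

Lemma dotpNr (R : realType) (n : nat) (x y : 'rV[R]_n) :
  dotp x (- y) = - dotp x y.
Proof. by rewrite -scaleN1r dotpZr mulN1r. Qed.

Lemma dotpBr (R : realType) (n : nat) (x y z : 'rV[R]_n) :
  dotp x (y - z) = dotp x y - dotp x z.
Proof. by rewrite dotpDr dotpNr. Qed.

Lemma dotpBl (R : realType) (n : nat) (x y z : 'rV[R]_n) :
  dotp (x - y) z = dotp x z - dotp y z.
Proof. by rewrite dotpC dotpBr !(dotpC z). Qed.

Lemma dotp0r (R : realType) (n : nat) (x : 'rV[R]_n) : dotp x 0 = 0.
Proof. by rewrite -(scale0r 0) dotpZr mul0r. Qed.

Lemma dotp_suml (R : realType) (n : nat) (I : finType) (F : I -> 'rV[R]_n)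
    (y : 'rV[R]_n) : dotp (\sum_i F i) y = \sum_i dotp (F i) y.
Proof.
rewrite dotpE mulmx_suml summxE; apply: eq_bigr => i _.
by rewrite dotpE.
Qed.

Lemma dotp_ge0 (R : realType) (n : nat) (x : 'rV[R]_n) : 0 <= dotp x x.
Proof. by apply: sumr_ge0 => i _; rewrite -expr2 sqr_ge0. Qed.

Lemma dotp_eq0 (R : realType) (n : nat) (x : 'rV[R]_n) :
  (dotp x x == 0) = (x == 0).
Proof.
apply/idP/eqP => [|->]; last by rewrite dotp0r.
rewrite psumr_eq0 => [|i _]; last by rewrite -expr2 sqr_ge0.
move=> /allP x0; apply/rowP => i; rewrite mxE.
by have := x0 i (mem_index_enum i); rewrite mulf_eq0 orbb => /eqP.
Qed.

Lemma enorm_ge0 (R : realType) (n : nat) (x : 'rV[R]_n) : 0 <= enorm x.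
Proof. exact: sqrtr_ge0. Qed.

Lemma enorm_sqr (R : realType) (n : nat) (x : 'rV[R]_n) :
  enorm x ^+ 2 = dotp x x.
Proof. exact/sqr_sqrtr/dotp_ge0. Qed.

Lemma enorm0 (R : realType) (n : nat) : enorm (0 : 'rV[R]_n) = 0.
Proof. by rewrite /enorm dotp0r sqrtr0. Qed.

Lemma enorm_gt0 (R : realType) (n : nat) (x : 'rV[R]_n) :
  (0 < enorm x) = (x != 0).
Proof. by rewrite sqrtr_gt0 lt_neqAle dotp_ge0 andbT eq_sym dotp_eq0. Qed.

Lemma enormZ (R : realType) (n : nat) (a : R) (x : 'rV[R]_n) :
  enorm (a *: x) = `|a| * enorm x.
Proof.
rewrite /enorm dotpZl dotpZr mulrA -expr2 sqrtrM ?sqr_ge0//.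
by rewrite sqrtr_sqr.
Qed.

Lemma enormN (R : realType) (n : nat) (x : 'rV[R]_n) : enorm (- x) = enorm x.
Proof. by rewrite -scaleN1r enormZ normrN1 mul1r. Qed.

Lemma cauchy_schwarz (R : realType) (n : nat) (x y : 'rV[R]_n) :
  `|dotp x y| <= enorm x * enorm y.
Proof.
have [->|x0] := eqVneq x 0; first by rewrite dotpC dotp0r normr0 enorm0 mul0r.
have xx0 : 0 < dotp x x by rewrite lt_neqAle dotp_ge0 andbT eq_sym dotp_eq0.
rewrite -(@ler_pXn2r _ 2)// ?nnegrE ?mulr_ge0 ?enorm_ge0//.
rewrite exprMn !enorm_sqr real_normK ?num_real//.
have := dotp_ge0 (dotp x x *: y - dotp x y *: x).
rewrite !(dotpBr, dotpBl, dotpZr, dotpZl) (dotpC y x).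
set a := dotp x x in xx0 *; set b := dotp x y; set c := dotp y y => h.
suff : 0 <= a * (a * c - b ^+ 2) by rewrite pmulr_rge0// subr_ge0.
apply: le_trans h _; rewrite le_eqVlt; apply/orP; left; apply/eqP; ring.
Qed.

Lemma enormD (R : realType) (n : nat) (x y : 'rV[R]_n) :
  enorm (x + y) <= enorm x + enorm y.
Proof.
rewrite -(@ler_pXn2r _ 2)// ?nnegrE ?addr_ge0 ?enorm_ge0//.
rewrite sqrrD !enorm_sqr dotpDl !dotpDr (dotpC y x).
have := le_trans (ler_norm _) (cauchy_schwarz x y).
rewrite mulr2n; lra.
Qed.

Lemma enorm_sum (R : realType) (n : nat) (I : finType) (F : I -> 'rV[R]_n) :
  enorm (\sum_i F i) <= \sum_i enorm (F i).
Proof.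
elim/big_ind2 : _ => [|x a y b xa yb|//]; first by rewrite enorm0.
exact: le_trans (enormD _ _) (lerD xa yb).
Qed.

Lemma enorm_mulmx (R : realType) (n : nat) (H : 'M[R]_n) (x : 'rV[R]_n) :
  H *m H^T = 1%:M -> enorm (x *m H) = enorm x.
Proof.
by move=> HH; rewrite /enorm !dotpE trmx_mul mulmxA -(mulmxA x) HH mulmx1.
Qed.

Lemma dotp_row_mx (R : realType) (m : nat) (s t : R) (x y : 'rV[R]_m) :
  dotp (row_mx s%:M x : 'rV_(1 + m)) (row_mx t%:M y) = s * t + dotp x y.
Proof.
by rewrite !dotpE tr_row_mx mul_row_col mxE tr_scalar_mx -scalar_mxM mxE.
Qed.

(** * Orthogonal reduction, Hadamard's inequality and dual vectors *)

Lemma normr_det_orthogonal (R : realType) (n : nat) (H : 'M[R]_n) :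
  H *m H^T = 1%:M -> `|\det H| = 1.
Proof.
move=> /(congr1 determinant); rewrite det_mulmx det_tr det1 -expr2 => h.
by apply/eqP; rewrite -(@eqrXn2 _ 2)// -normrX h normr1 expr1n.
Qed.

Lemma orthogonal_to_e0 (R : realType) (m : nat) (u : 'rV[R]_m.+1) :
  dotp u u = 1 ->
  exists2 H : 'M[R]_m.+1, H *m H^T = 1%:M & delta_mx 0 0 *m H = u.
Proof.
move=> u1; set e := delta_mx 0 0 : 'rV[R]_m.+1.
have e1 : dotp e e = 1 by rewrite dotpE trmx_delta mul_delta_mx mxE !eqxx.
have [->|ue] := eqVneq u e.
  by exists 1%:M; [rewrite trmx1 mulmx1 | rewrite mulmx1].
(* [H] is the Householder reflection exchanging [e] and [u]. *)
have [v vE] : exists v, v = u - e by exists (u - e).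
have v0 : dotp v v != 0 by rewrite dotp_eq0 vE subr_eq0.
pose a := 2 / dotp v v.
have vv : v *m v^T = (dotp v v)%:M by rewrite [LHS]mx11_scalar -dotpE.
pose H := 1%:M - a *: (v^T *m v).
have HT : H^T = H.
  by rewrite /H linearB/= trmx1 linearZ/= trmx_mul trmxK.
exists H.
  have PP : v^T *m v *m (v^T *m v) = dotp v v *: (v^T *m v).
    by rewrite -mulmxA (mulmxA v) vv mul_scalar_mx scalemxAr.
  rewrite HT /H mulmxBl mul1mx mulmxBr mulmx1.
  rewrite -scalemxAl -scalemxAr PP !scalerA.
  rewrite (_ : a * _ * _ = a + a); last by rewrite /a; field.
  by rewrite scalerDl opprB addrK subrK.
(* Since [e] and [u] are unit vectors, the reflection moves [e] by exactly [v = u - e]. *)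
have vvE : dotp v v = - (2 * dotp e v).
  by rewrite vE !(dotpBr, dotpBl) u1 e1 (dotpC u e); ring.
rewrite /H mulmxBr mulmx1 -scalemxAr mulmxA [e *m _]mx11_scalar -dotpE.
rewrite mul_scalar_mx scalerA.
rewrite (_ : a * dotp e v = -1); first by rewrite scaleN1r opprK vE addrC subrK.
have ev0 : dotp e v != 0.
  by apply: contra v0 => /eqP ev; rewrite vvE ev mulr0 oppr0.
by rewrite /a vvE; field.
Qed.

(* Rotating the dual vector of the first row onto the first axis makes the
   first column of [A] vanish below the diagonal. *)
Lemma block_triangularize (R : realType) (m : nat) (A : 'M[R]_(1 + m)) :
  A \in unitmx ->
  exists (H : 'M[R]_(1 + m)) (t : R) (r : 'rV[R]_m) (B : 'M[R]_m),
    [/\ H *m H^T = 1%:M, 0 < t, A *m H = block_mx t%:M r 0 B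
      & t * enorm (col 0 (invmx A))^T = 1].
Proof.
move=> uA; pose w := (col 0 (invmx A))^T.
have w0 : w != 0.
  apply/eqP => w0; have : (A *m invmx A) 0 0 = 0.
    rewrite mxE big1// => i _.
    by move/rowP : w0 => /(_ i); rewrite !mxE => ->; rewrite mulr0.
  by move/eqP; rewrite mulmxV// mxE eqxx oner_eq0.
have w1 : 0 < enorm w by rewrite enorm_gt0.
pose t := (enorm w)^-1.
have [|H HH He] := @orthogonal_to_e0 R m (t *: w).
  by rewrite dotpZl dotpZr -enorm_sqr /t; field; rewrite gt_eqF.
(* [w] is the dual vector of the first row: it has inner product 1 with that row and 0 with all the
   others. *)
have AH0 i : (A *m H^T) i 0 = t * (i == 0)%:R.
  have -> : (A *m H^T) i 0 = dotp (row i A) (t *: w).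
    rewrite dotpE -He trmx_mul mulmxA -row_mul trmx_delta -colE.
    by rewrite !mxE.
  by rewrite dotpZr dotpE trmxK -row_mul colE mulmxA mulmxV// mul1mx !mxE eqxx
    andbT.
exists H^T, t, (ursubmx (A *m H^T : 'M[R]_(1 + m))),
  (drsubmx (A *m H^T : 'M[R]_(1 + m))); split.
- by rewrite trmxK; apply: mulmx1C.
- by rewrite invr_gt0.
- rewrite -[LHS]submxK; congr block_mx; apply/matrixP => i j.
    rewrite !ord1 mxE mxE (_ : lshift m 0 = 0); last exact/val_inj.
    by rewrite AH0 eqxx mulr1 mxE eqxx.
  rewrite mxE mxE ord1 (_ : lshift m 0 = 0); last exact/val_inj.
  by rewrite AH0 mxE (_ : _ == _ = false) ?mulr0.
- by rewrite mulVf// gt_eqF.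
Qed.

Lemma row_block_mx_mulV (R : realType) (m : nat) (A H : 'M[R]_(1 + m)) (t : R)
    (r : 'rV[R]_m) (B : 'M[R]_m) :
  H *m H^T = 1%:M -> A *m H = block_mx t%:M r 0 B ->
  enorm (row 0 A) = enorm (row_mx t%:M r) /\
  forall i, enorm (row (rshift 1 i) A) = enorm (row i B).
Proof.
move=> HH AH; split => [|i].
  rewrite -(enorm_mulmx _ HH) -row_mul AH /block_mx.
  have -> : row 0 (col_mx (row_mx t%:M r) (row_mx 0 B)) = row_mx t%:M r.
    apply/rowP => j; rewrite mxE mxE.
    by case: splitP => k; rewrite ?ord1.
  by [].
rewrite -(enorm_mulmx _ HH) -row_mul AH /block_mx rowKd row_row_mx row0.
rewrite (_ : 0 = (0%:M : 'M[R]_1)); last by rewrite raddf0.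
by rewrite /enorm dotp_row_mx mulr0 add0r.
Qed.

(** Induction through the block-triangular form: the rotation preserves row norms, so the first row
    has norm at least [t], and the rows of [B] are as long as the remaining rows of [A]. *)
Lemma hadamard (R : realType) (n : nat) (A : 'M[R]_n) :
  `|\det A| <= \prod_i enorm (row i A).
Proof.
elim: n A => [|m IH] A; first by rewrite det_mx00 big_ord0 normr1.
have [uA|] := boolP (A \in unitmx); last first.
  rewrite unitmxE unitfE negbK => /eqP ->.
  by rewrite normr0 prodr_ge0// => i _; apply: enorm_ge0.
have [H [t [r [B [HH t0 AH _]]]]] := @block_triangularize R m A uA.
have [r0 ri] := row_block_mx_mulV HH AH.
have -> : `|\det A| = t * `|\det B|.
  have := congr1 (fun M => `|\det M|) AH.
  rewrite det_mulmx normrM (normr_det_orthogonal HH) mulr1 => ->.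
  by rewrite (@det_ublock _ 1) det_scalar1 normrM gtr0_norm.
rewrite big_ord_recl; apply: ler_pM => //; first exact: ltW.
  rewrite r0 -(@ler_pXn2r _ 2)//; [|exact: ltW|exact: enorm_ge0].
  by rewrite enorm_sqr dotp_row_mx expr2 lerDl dotp_ge0.
apply: le_trans (IH B) _; rewrite le_eqVlt; apply/orP; left; apply/eqP.
apply: eq_bigr => i _; rewrite -ri; congr (enorm (row _ A)); exact/val_inj.
Qed.

(** With row [j] swapped to the front, [|det A| = t |det B|], where [t] is the inverse of the norm
    of the dual vector. The left side is thus [|det B|], to which Hadamard's inequality applies. *)
Lemma enorm_dual_le (R : realType) (m : nat) (A : 'M[R]_m.+1) (l : R)
    (j : 'I_m.+1) :
  A \in unitmx -> (forall i, enorm (row i A) <= l) ->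
  `|\det A| * enorm (col j (invmx A))^T <= l ^+ m.
Proof.
move=> uA Al; pose P := tperm_mx 0 j : 'M[R]_m.+1; pose A1 := P *m A.
have uP : P \in unitmx by apply: unitmx_perm.
have uA1 : A1 \in unitmx by rewrite unitmx_mul uP.
have A1l i : enorm (row i A1) <= l.
  rewrite (_ : row i A1 = row (tperm 0 j i) A) //.
  by rewrite /A1 /P /tperm_mx -row_permE; apply/rowP => k; rewrite !mxE.
have -> : col j (invmx A) = col 0 (invmx A1).
  have PP : P *m P = 1%:M by rewrite /P /tperm_mx -perm_mxM tperm2 perm_mx1.
  have VA1 : invmx A *m P *m A1 = 1%:M.
    by rewrite /A1 mulmxA -(mulmxA _ P P) PP mulmx1 mulVmx.
  have -> : invmx A1 = invmx A *m P.
    by rewrite -[RHS]mulmx1 -(mulmxV uA1) mulmxA VA1 mul1mx.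
  rewrite !colE -mulmxA; congr (_ *m _); rewrite -colE.
  apply/matrixP => a b; rewrite !mxE tpermC.
  rewrite ord1 eqxx andbT.
  case: tpermP => [->|->|/eqP aj /eqP a0]; rewrite ?eqxx//.
    by rewrite eq_sym.
  by rewrite (negbTE aj) (negbTE a0).
have -> : `|\det A| = `|\det A1|.
  by rewrite det_mulmx det_perm normrM normrX normrN1 expr1n mul1r.
have [H [t [r [B [HH t0 AH tw]]]]] := @block_triangularize R m A1 uA1.
have [r0 ri] := row_block_mx_mulV HH AH.
have -> : `|\det A1| = t * `|\det B|.
  have := congr1 (fun M => `|\det M|) AH.
  rewrite det_mulmx normrM (normr_det_orthogonal HH) mulr1 => ->.
  by rewrite (@det_ublock _ 1) det_scalar1 normrM gtr0_norm.
rewrite mulrAC tw mul1r.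
apply: le_trans (hadamard B) _.
rewrite -[m in leRHS](card_ord m) -prodr_const.
by apply: ler_prod => i _; rewrite enorm_ge0 -ri A1l.
Qed.

(** * Volumes of Euclidean balls by slicing *)

(** The image of [a] times Lebesgue measure under [s |-> a s + b] agrees with Lebesgue measure on
    half-open intervals, hence equals it. *)
Lemma ge0_integral_affine (R : realType) (f : R -> \bar R) (a b : R) (D : set R) :
  0 < a -> measurable D -> measurable_fun D f ->
  (forall x, D x -> 0 <= f x)%E ->
  (\int[lebesgue_measure]_(x in D) f x =
   a%:E * \int[lebesgue_measure]_(x in (fun s => (a * s + b)%R) @^-1` D)
     f (a * x + b)%R)%E.
Proof.
move=> a0 mD mf f0; pose phi : R -> R := fun s => a * s + b.
have mphi : measurable_fun setT phi.
  by apply: measurable_funD => //; apply: measurable_funM.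
have leb A : measurable A ->
    pushforward (mscale (NngNum (ltW a0)) lebesgue_measure)
      (phi : measurableTypeR R -> measurableTypeR R) A = lebesgue_measure A.
  move=> mA; apply/esym.
  apply: lebesgue_measure_unique => // _ [[x y]] _ <-.
  have phiV : phi @^-1` `]x, y] = `](x - b) / a, (y - b) / a]%classic.
    by apply/seteqP; split => s /=; rewrite !in_itv/= /phi
      ltr_pdivrMr// ler_pdivlMr// ltrBlDr lerBrDr mulrC.
  rewrite [RHS](_ : _ = (a%:E * lebesgue_measure (phi @^-1` `]x, y]))%E)// phiV.
  rewrite !lebesgue_measure_itv/= !lte_fin ltr_pM2r ?invr_gt0// ltrD2r.
  case: ifP => // _; last by rewrite mule0.
  by rewrite -!EFinD -EFinM; congr EFin; field; rewrite gt_eqF.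
transitivity (\int[pushforward (mscale (NngNum (ltW a0)) lebesgue_measure)
    (phi : measurableTypeR R -> measurableTypeR R)]_(x in D) f x)%E.
  by apply: eq_measure_integral => A mA _; apply/esym/leb.
rewrite ge0_integral_pushforward//; last by move=> x /set_mem; apply: f0.
have mphiD : measurable (phi @^-1` D).
  by rewrite -[X in measurable X]setTI; apply: mphi.
rewrite ge0_integral_mscale//=.
  apply: measurable_comp mD _ mf (measurable_funTS mphi).
  by move=> _ [s Ds <-].
by move=> x; apply: f0.
Qed.

(* The [m]-th power of the radius of the ball [|x|^2 <= q], and [0] when that
   ball is empty.  The case distinction matters for [m = 0]. *)
Definition rpow (R : realType) (m : nat) (q : R) : R :=
  if 0 <= q then Num.sqrt q ^+ m else 0.

Lemma rpow_ge0 (R : realType) (m : nat) (q : R) : 0 <= rpow m q.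
Proof. by rewrite /rpow; case: ifP => // _; rewrite exprn_ge0 ?sqrtr_ge0. Qed.

Lemma rpow_lt0 (R : realType) (m : nat) (q : R) : q < 0 -> rpow m q = 0.
Proof. by rewrite /rpow leNgt => ->. Qed.

Lemma rpow_sqr (R : realType) (m : nat) (a : R) : 0 <= a -> rpow m (a ^+ 2) = a ^+ m.
Proof. by move=> a0; rewrite /rpow sqr_ge0 sqrtr_sqr ger0_norm. Qed.

Lemma rpowM (R : realType) (m : nat) (a q : R) :
  0 < a -> rpow m (a ^+ 2 * q) = a ^+ m * rpow m q.
Proof.
move=> a0; rewrite /rpow pmulr_rge0 ?exprn_gt0//.
case: ifP => _; last by rewrite mulr0.
by rewrite sqrtrM ?sqr_ge0// sqrtr_sqr gtr0_norm// exprMn.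
Qed.

Lemma measurable_rpow (R : realType) (m : nat) :
  measurable_fun [set: R] (@rpow R m).
Proof.
apply: measurable_fun_if => //.
- exact: measurable_fun_ler.
- apply: measurable_funTS; apply: measurable_funX.
  by apply: continuous_measurable_fun; apply: sqrt_continuous.
Qed.

Lemma measurable_rpow_section (R : realType) (m : nat) (q c : R) :
  measurable_fun [set: R] (fun t : R => (rpow m (q - (t - c) ^+ 2))%:E).
Proof.
apply/measurable_EFinP; apply: (measurableT_comp (@measurable_rpow R m)).
apply: measurable_funB => //; apply: measurable_funX.
exact: measurable_funB.
Qed.

Lemma integral_indic_segment (R : realType) (a b : R) :
  (\int[lebesgue_measure]_(t in [set: R]) (\1_`[a, b]%classic t)%:E =
   if (a < b)%R then (b - a)%:E else 0)%E.
Proof.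
rewrite integral_indic// setIT.
by apply: etrans (lebesgue_measure_itv _) _; rewrite /= lte_fin.
Qed.

(** The ratio of the volumes of the unit balls in dimensions [m + 1] and [m]. *)
Definition section_const (R : realType) (m : nat) : R :=
  fine (\int[lebesgue_measure]_t (rpow m (1 - t ^+ 2))%:E)%E.

(** The integrand is at most the indicator of [[-1, 1]] and at least [2^-m] on [[-1/2, 1/2]], so the
    integral is finite and positive. *)
Lemma section_const_spec (R : realType) (m : nat) :
  (\int[lebesgue_measure]_t (rpow m (1 - t ^+ 2))%:E)%E = (section_const R m)%:E
  /\ 0 < section_const R m.
Proof.
have mF : measurable_fun [set: R] (fun t : R => (rpow m (1 - t ^+ 2))%:E).
  have := @measurable_rpow_section R m 1 0.
  by under eq_fun do rewrite subr0.
have int_le : (\int[lebesgue_measure]_(t in [set: R]) (rpow m (1 - t ^+ 2))%:E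
    <= 2%:E)%E.
  apply: (@le_trans _ _ (\int[lebesgue_measure]_(t in [set: R]) (\1_`[(-1 : R), 1]%classic t)%:E)%E).
    apply: ge0_le_integral => //.
    - by move=> t _; rewrite lee_fin rpow_ge0.
    - by apply/measurable_EFinP; apply: measurable_indic.
    move=> t _; rewrite lee_fin indicE /rpow.
    have [q0|] := leP 0 (1 - t ^+ 2); last by rewrite ler0n.
    rewrite mem_set /=; last by rewrite in_itv/=; apply/andP; split; nra.
    rewrite exprn_ile1 ?sqrtr_ge0// -[leRHS]sqrtr1 ler_wsqrtr//.
    by have := sqr_ge0 t; lra.
  by rewrite integral_indic_segment ifT; [rewrite lee_fin|]; lra.
have int_ge : ((2^-1 ^+ m)%:E <=
    \int[lebesgue_measure]_(t in [set: R]) (rpow m (1 - t ^+ 2))%:E)%E.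
  pose I : set R := `[- 2^-1, 2^-1]%classic.
  have mI : measurable I by exact: measurable_itv.
  apply: (@le_trans _ _ (\int[lebesgue_measure]_(t in I) (2^-1 ^+ m)%:E)%E).
    rewrite integral_cst// [X in (_ * X)%E](_ : _ = 1%E) ?mule1//.
    apply: etrans (lebesgue_measure_itv _) _; rewrite /= lte_fin.
    by rewrite ifT; [rewrite -EFinB; congr EFin; field | lra].
  apply: (@le_trans _ _ (\int[lebesgue_measure]_(t in I) (rpow m (1 - t ^+ 2))%:E)%E); last first.
    by apply: ge0_subset_integral => // t _; rewrite lee_fin rpow_ge0.
  apply: ge0_le_integral => //.
    exact: measurable_funTS.
  move=> t; rewrite /I /= in_itv/= => /andP[t1 t2]; rewrite lee_fin.
  have q4 : 2^-1 ^+ 2 <= 1 - t ^+ 2 by nra.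
  rewrite -(rpow_sqr m (a := 2^-1))// /rpow sqr_ge0 (le_trans _ q4) ?sqr_ge0//.
  by apply: lerXn2r; rewrite ?nnegrE ?sqrtr_ge0// ler_wsqrtr.
have fin : (\int[lebesgue_measure]_(t in [set: R]) (rpow m (1 - t ^+ 2))%:E)%E
    \is a fin_num.
  apply/fin_numPlt; rewrite (le_lt_trans int_le (ltry _)) andbT.
  exact: lt_le_trans (ltNyr _) int_ge.
split; first by rewrite fineK.
rewrite -lte_fin fineK//; apply: lt_le_trans int_ge.
by rewrite lte_fin exprn_gt0.
Qed.

(** For [q > 0] the substitution [t = sqrt q s + c] reduces to the unit ball. *)
Lemma integral_rpow_section (R : realType) (m : nat) (q c : R) :
  (\int[lebesgue_measure]_t (rpow m (q - (t - c) ^+ 2))%:E)%E =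
  (section_const R m * rpow m.+1 q)%:E.
Proof.
have [q0|q0|->] := ltgtP q 0.
- rewrite rpow_lt0// mulr0; apply: integral0_eq => t _.
  by rewrite rpow_lt0//; have := sqr_ge0 (t - c); lra.
- have sq0 : 0 < Num.sqrt q by rewrite sqrtr_gt0.
  have F0 t : [set: R] t -> (0 <= (rpow m (q - (t - c) ^+ 2))%:E)%E.
    by move=> _; rewrite lee_fin rpow_ge0.
  rewrite (ge0_integral_affine c sq0 measurableT
    (measurable_rpow_section m q c) F0).
  rewrite preimage_setT.
  under eq_integral => t _.
    rewrite addrK exprMn sqr_sqrtr ?ltW// -[X in X - _]mulr1 -mulrBr.
    rewrite -[X in X * _](sqr_sqrtr (ltW q0)) rpowM// EFinM.
  over.
  have mF : measurable_fun [set: R] (fun t : R => (rpow m (1 - t ^+ 2))%:E).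
    have := measurable_rpow_section m 1 (0 : R).
    by under eq_fun do rewrite subr0.
  have F10 (t : R) : [set: R] t -> (0 <= (rpow m (1 - t ^+ 2))%:E)%E.
    by move=> _; rewrite lee_fin rpow_ge0.
  have sqm : (0 <= (Num.sqrt q ^+ m)%:E)%E.
    by rewrite lee_fin exprn_ge0 ?sqrtr_ge0.
  rewrite ge0_integralZl//.
  rewrite (section_const_spec R m).1 -!EFinM; congr EFin.
  by rewrite /rpow ltW// exprS; ring.
(* For [q = 0] the integrand vanishes off the null set [{c}]; at [c] it is still 1 when [m = 0]. *)
- rewrite {2}/rpow lexx sqrtr0 expr0n mulr0.
  apply/eqP; rewrite eq_le; apply/andP; split; last first.
    by apply: integral_ge0 => t _; rewrite lee_fin rpow_ge0.
  apply: (@le_trans _ _ (\int[lebesgue_measure]_(t in [set: R]) (\1_`[c, c]%classic t)%:E)%E).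
    apply: ge0_le_integral => //.
    + by move=> t _; rewrite lee_fin rpow_ge0.
    + exact: measurable_rpow_section.
    + by apply/measurable_EFinP; apply: measurable_indic.
    move=> t _; rewrite lee_fin indicE /rpow sub0r oppr_ge0.
    case: ifPn => [t0|_]; last by rewrite ler0n.
    have /eqP : (t - c) ^+ 2 = 0 by apply/eqP; rewrite eq_le t0 sqr_ge0.
    rewrite sqrf_eq0 subr_eq0 => /eqP ->.
    by rewrite mem_set/= ?in_itv/= ?lexx// subrr expr0n oppr0 sqrtr0 exprn_ile1.
  by rewrite integral_indic_segment ltxx.
Qed.

Definition ball_volume (R : realType) (n : nat) : R :=
  \prod_(i < n) section_const R i.

Lemma ball_volume_gt0 (R : realType) (n : nat) : 0 < ball_volume R n.
Proof. by apply: prodr_gt0 => i _; case: (section_const_spec R i). Qed.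

Lemma integral_ball_section (R : realType) (m : nat) (q c : R) :
  (\int[lebesgue_measure]_t (ball_volume R m * rpow m (q - (t - c) ^+ 2))%:E)%E =
  (ball_volume R m.+1 * rpow m.+1 q)%:E.
Proof.
under eq_integral do rewrite EFinM.
rewrite ge0_integralZl//.
- rewrite integral_rpow_section -EFinM mulrA; congr (_ * _)%:E.
  by rewrite /ball_volume big_ord_recr.
- exact: measurable_rpow_section.
- by move=> t _; rewrite lee_fin rpow_ge0.
- by rewrite lee_fin ltW// ball_volume_gt0.
Qed.

(** The section at first coordinate [t] is a ball of squared radius [q - (t - a)^2]. This may be
    negative, so the induction runs over all real [q]. *)
Lemma volume_ball (R : realType) (n : nat) (c : 'rV[R]_n) (q : R) :
  volume [set x | dotp (x - c) (x - c) <= q] = (ball_volume R n * rpow n q)%:E.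
Proof.
elim: n c q => [|m IH] c q /=.
  rewrite /ball_volume big_ord0 mul1r /rpow indicE; congr EFin.
  have [q0|q0] := leP 0 q; last rewrite memNset//=.
    by rewrite mem_set//= /dotp big_ord0.
  by rewrite /dotp big_ord0 => /(lt_le_trans q0); rewrite ltxx.
have [a [b cE]] : exists a b, c = row_mx a%:M b :> 'rV[R]_(1 + m).
  exists (lsubmx (c : 'rV[R]_(1 + m)) 0 0), (rsubmx (c : 'rV[R]_(1 + m))).
  by rewrite -mx11_scalar hsubmxK.
rewrite -(integral_ball_section m q a).
apply: eq_integral => t _; rewrite -(IH b); congr volume.
have h (x : 'rV[R]_m) : (row_mx t%:M x : 'rV[R]_(1 + m)) - row_mx a%:M b =
    row_mx (t - a)%:M (x - b).
  by rewrite opp_row_mx add_row_mx raddfB.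
by apply/seteqP; split => x /=; rewrite cE h dotp_row_mx -expr2; lra.
Qed.

Lemma omegaE (R : realType) (n : nat) : omega R n = ball_volume R n.
Proof.
rewrite /omega (_ : [set _ | _] = [set x : 'rV[R]_n | dotp (x - 0) (x - 0) <= 1]).
  by rewrite volume_ball /= -(expr1n _ 2) rpow_sqr// expr1n mulr1.
apply/seteqP; split => x /=; rewrite subr0 /enorm => x1.
  by rewrite -(expr1n R 2) -ler_sqrt ?exprn_gt0// sqrtr_sqr normr1.
by rewrite -sqrtr1 ler_sqrt.
Qed.

(** * Lattice packings of balls and Minkowski's bound *)

(** This folds an integral over [k] periods onto the single period [[0, t[]. *)
Lemma ge0_integral_translates (R : realType) (f : R -> \bar R) (a t : R) (k : nat) :
  0 < t -> measurable_fun [set: R] f -> (forall x, 0 <= f x)%E ->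
  (\int[lebesgue_measure]_(x in `[a, (a + k%:R * t)%R[) f x =
   \sum_(i < k) \int[lebesgue_measure]_(x in `[0%R, t[) f (x + (a + i%:R * t))%R)%E.
Proof.
move=> t0 mf f0; elim: k => [|k IH].
  by rewrite big_ord0 mul0r addr0 set_itvco0 integral_set0.
have kt : a + k%:R * t <= a + k.+1%:R * t.
  by rewrite lerD2l ler_wpM2r ?(ltW t0)// ler_nat.
have ak : a <= a + k%:R * t by rewrite lerDl mulr_ge0// (ltW t0).
rewrite big_ord_recr/= -IH.
rewrite (_ : `[a, (a + k.+1%:R * t)%R[%classic =
  `[a, (a + k%:R * t)[%classic `|` `[a + k%:R * t, (a + k.+1%:R * t)[%classic); last first.
  by rewrite -itv_bndbnd_setU// bnd_simp.
rewrite ge0_integral_setU//=; last 2 first.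
- exact: measurable_funTS.
- apply/disj_setPRL => x /=; rewrite !in_itv/= => /andP[x1 _].
  by rewrite ltNge x1 andbF.
congr (_ + _)%E.
rewrite (@ge0_integral_affine _ _ 1 (a + k%:R * t))//; last exact: measurable_funTS.
rewrite mul1e (_ : _ @^-1` _ = `[0, t[%classic); last first.
  apply/seteqP; split => x /=; rewrite !in_itv/= -natr1; lra.
by apply: eq_integral => x _; rewrite mul1r.
Qed.

(** Parallel sections of disjoint balls are disjoint: [h], [h'] are the offsets of the sections from
    the centres, and [d] is the distance between the centres of the sections. The key inequality
    [cs] is Cauchy-Schwarz for [(s, h)] and [(s', -h')], of norms [r] and [r']. *)
Lemma sqrt_section_lt (R : realType) (p p' h h' d : R) :
  0 <= p - h ^+ 2 -> 0 <= p' - h' ^+ 2 ->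
  Num.sqrt p + Num.sqrt p' < Num.sqrt ((h' - h) ^+ 2 + d ^+ 2) -> 0 <= d ->
  Num.sqrt (p - h ^+ 2) + Num.sqrt (p' - h' ^+ 2) < d.
Proof.
move=> ph ph' ltd d0.
have p0 : 0 <= p by have := sqr_ge0 h; lra.
have p0' : 0 <= p' by have := sqr_ge0 h'; lra.
set s := Num.sqrt (p - _); set s' := Num.sqrt (p' - _).
have [s0 s0'] : 0 <= s /\ 0 <= s' by rewrite !sqrtr_ge0.
have sE : s ^+ 2 = p - h ^+ 2 by rewrite sqr_sqrtr.
have sE' : s' ^+ 2 = p' - h' ^+ 2 by rewrite sqr_sqrtr.
move: ltd; set r := Num.sqrt p; set r' := Num.sqrt p' => ltd.
have [r0 r0'] : 0 <= r /\ 0 <= r' by rewrite !sqrtr_ge0.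
have rE : r ^+ 2 = p by rewrite sqr_sqrtr.
have rE' : r' ^+ 2 = p' by rewrite sqr_sqrtr.
have : (r + r') ^+ 2 < (h' - h) ^+ 2 + d ^+ 2.
  rewrite -[ltRHS]sqr_sqrtr ?addr_ge0 ?sqr_ge0//.
  by rewrite ltr_pXn2r ?nnegrE ?addr_ge0 ?sqrtr_ge0.
have cs : s * s' - h * h' <= r * r'.
  apply: le_trans (ler_norm _) _.
  rewrite -(@ler_pXn2r _ 2)// ?nnegrE ?mulr_ge0// real_normK ?num_real//.
  rewrite [leRHS]exprMn rE rE'.
  have -> : p = s ^+ 2 + h ^+ 2 by rewrite sE subrK.
  have -> : p' = s' ^+ 2 + h' ^+ 2 by rewrite sE' subrK.
  by have := sqr_ge0 (s * h' + h * s'); lra.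
rewrite !(sqrrB, sqrrD) rE rE' => lt2.
rewrite -(@ltr_pXn2r _ 2)// ?nnegrE ?addr_ge0//.
by rewrite sqrrD sE sE'; lra.
Qed.

(** The hypothesis makes all lattice translates of the nonempty balls pairwise disjoint; a negative
    [q j] stands for an empty ball. Several balls of unequal, possibly empty, radii are allowed
    because slicing a single ball already produces such a family. *)
Lemma lattice_packing (R : realType) (n : nat) (A : 'M[R]_n) (J : finType)
    (c : J -> 'rV[R]_n) (q : J -> R) :
  A \in unitmx ->
  (forall j j' (z : 'rV[int]_n), 0 <= q j -> 0 <= q j' ->
     ~ (j = j' /\ z = 0) ->
     Num.sqrt (q j) + Num.sqrt (q j') < enorm (c j - c j' + map_mx intr z *m A)) ->
  \sum_j ball_volume R n * rpow n (q j) <= `|\det A|.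
Proof.
elim: n A J c q => [|m IH] A J c q uA pack.
  (* In dimension 0 all distances vanish, so at most one ball is nonempty, and it has volume 1. *)
  rewrite det_mx00 normr1 /ball_volume big_ord0.
  under eq_bigr do rewrite mul1r.
  have [j0 qj0|qn] := pickP (fun j => 0 <= q j); last first.
    by rewrite big1// => j _; rewrite /rpow qn.
  rewrite (bigD1 j0)//= big1 ?addr0; first by rewrite /rpow qj0.
  move=> j jj0; rewrite /rpow; case: ifP => // qj.
  have neq : ~ (j = j0 /\ 0 = 0 :> 'rV[int]_0).
    by case=> /eqP; rewrite (negbTE jj0).
  have := pack _ _ _ qj qj0 neq.
  rewrite [X in _ < X]/enorm /dotp big_ord0 sqrtr0 => lt0.
  by have := lt_le_trans lt0 (addr_ge0 (sqrtr_ge0 (q j)) (sqrtr_ge0 (q j0))); rewrite ltxx.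
have [H [t [r [B [HH t0 AH _]]]]] := @block_triangularize R m A uA.
have detA : `|\det A| = t * `|\det B|.
  have := congr1 (fun M => `|\det M|) AH.
  rewrite det_mulmx normrM (normr_det_orthogonal HH) mulr1 => ->.
  by rewrite (@det_ublock _ 1) det_scalar1 normrM gtr0_norm.
have uB : B \in unitmx.
  rewrite unitmxE unitfE -normr_gt0 -(pmulr_rgt0 _ t0) -detA normr_gt0.
  by rewrite -unitfE -unitmxE.
have [x [y cH]] : exists (x : J -> R) (y : J -> 'rV[R]_m),
    forall j, c j *m H = row_mx (x j)%:M (y j) :> 'rV[R]_(1 + m).
  exists (fun j => lsubmx (c j *m H : 'rV[R]_(1 + m)) 0 0).
  exists (fun j => rsubmx (c j *m H : 'rV[R]_(1 + m))) => j.
  by rewrite -mx11_scalar hsubmxK.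
pose F j (s : R) := (ball_volume R m * rpow m (q j - (s - x j) ^+ 2))%:E.
have F0 j s : (0 <= F j s)%E.
  by rewrite lee_fin mulr_ge0 ?rpow_ge0// ltW// ball_volume_gt0.
have mF j : measurable_fun [set: R] (F j).
  apply/measurable_EFinP; apply: measurable_funM; first exact: measurable_cst.
  by have /measurable_EFinP := measurable_rpow_section m (q j) (x j).
(* Every ball projects into []-M, M[] on the first axis, so [K] periods starting at [-M] cover them
   all. *)
pose M : R := \sum_j (`|x j| + Num.sqrt (q j)) + 1.
have [K MK] : exists K : nat, 2 * M < K%:R * t.
  exists (Num.bound `|2 * M / t|); rewrite -ltr_pdivrMr//.
  by apply: le_lt_trans (ler_norm _) (archi_boundP (normr_ge0 _)).
pose a : R := - M.
have int_window j : (\int[lebesgue_measure]_s F j s =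
    \int[lebesgue_measure]_(s in `[a, (a + K%:R * t)%R[) F j s)%E.
  rewrite [RHS]integral_mkcond; apply: eq_integral => s _.
  rewrite patchE; case: ifPn => // /negP sK.
  rewrite /F rpow_lt0 ?mulr0// subr_lt0 ltNge; apply/negP => sq; apply: sK.
  have sx : `|s - x j| <= Num.sqrt (q j) by rewrite -sqrtr_sqr ler_wsqrtr.
  have xM : `|x j| + Num.sqrt (q j) + 1 <= M.
    rewrite /M (bigD1 j)//= lerD2r lerDl; apply: sumr_ge0 => i _.
    by apply: addr_ge0; rewrite ?normr_ge0 ?sqrtr_ge0.
  have := ler_norm (x j); have := ler_norm (- x j); rewrite normrN.
  move: sx; rewrite ler_norml => /andP[].
  by rewrite inE /= in_itv/= /a => *; apply/andP; split; lra.
(* The slice at height [s + a + i t] is brought to height [s + a] by subtracting [i] times the first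
   generator, whose component in the hyperplane is [r]. The slices at all [K] heights then form one
   packing modulo [B]. *)
have slice (s : R) : \sum_(p : J * 'I_K) ball_volume R m *
    rpow m (q p.1 - (s + (a + p.2%:R * t) - x p.1) ^+ 2) <= `|\det B|.
  apply: (IH B _ (fun p : J * 'I_K => y p.1 - p.2%:R *: r)
    (fun p : J * 'I_K => q p.1 - (s + (a + p.2%:R * t) - x p.1) ^+ 2)) => //.
  move=> [j i] [j' i'] z /= qj qj' neq.
  set u := (X in enorm X).
  (* The lattice vector relating the two original balls: its first coordinate undoes the shifts by
     [i] and [i']. *)
  pose Z : 'rV[int]_(1 + m) := row_mx ((i' : nat)%:Z - (i : nat)%:Z)%:M z.
  have neqZ : ~ (j = j' /\ Z = 0).
    case=> jj' /eqP; rewrite row_mx_eq0 => /andP[/eqP ii' /eqP z0]; apply: neq.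
    move/matrixP : ii' => /(_ 0 0); rewrite !mxE eqxx => /subr0_eq[ii'].
    by split=> //; rewrite jj'; congr pair; apply/val_inj.
  have cZ : (c j - c j' + map_mx intr Z *m A) *m H =
      row_mx (x j - x j' + (i'%:R - i%:R) * t)%:M u.
    rewrite mulmxDl mulmxBl !cH -mulmxA AH /Z map_row_mx map_scalar_mx/=.
    rewrite mul_row_block mulmx0 addr0 -scalar_mxM !mul_scalar_mx.
    rewrite opp_row_mx !add_row_mx -!raddfB/= -raddfD/= rmorphB/=.
    congr row_mx; rewrite /u scalerBl addrA; congr (_ + _).
    rewrite opprB [X in _ + X = _]addrC addrACA; congr (_ + _).
    exact: addrC.
  apply: (sqrt_section_lt qj qj') (enorm_ge0 u).
  have qge (p h : R) : 0 <= p - h ^+ 2 -> 0 <= p by have := sqr_ge0 h; lra.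
  have := pack j j' Z (qge _ _ qj) (qge _ _ qj') neqZ.
  rewrite -(enorm_mulmx _ HH) cZ {1}/enorm dotp_row_mx -enorm_sqr -expr2.
  by congr (_ < Num.sqrt (_ ^+ 2 + _)); ring.
rewrite -lee_fin -sumEFin.
under eq_bigr => j _.
  rewrite -(integral_ball_section _ _ (x j)) int_window.
  rewrite ge0_integral_translates//.
over.
rewrite pair_big/=.
have mG (p : J * 'I_K) : measurable_fun `[0, t[%classic
    (fun s : R => F p.1 (s + (a + p.2%:R * t))).
  apply: measurable_funTS; apply: measurableT_comp => //.
  exact: measurable_funD.
have G0 (p : J * 'I_K) (s : R) :
    `[0, t[%classic s -> (0 <= F p.1 (s + (a + p.2%:R * t))%R)%E.
  by move=> _; apply: F0.
rewrite -ge0_integral_sum//.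
apply: (@le_trans _ _ (\int[lebesgue_measure]_(s in `[0%R, t[) `|\det B|%:E)%E).
  apply: ge0_le_integral => //=.
  + by move=> s st; apply: sume_ge0 => p _; apply: G0.
  + by apply: emeasurable_sum => p; apply: mG.
  move=> s _; rewrite sumEFin lee_fin; apply: slice.
rewrite integral_cst//= [X in (_ * X)%E](_ : _ = t%:E).
  by rewrite -EFinM lee_fin detA mulrC.
by apply: etrans (lebesgue_measure_itv _) _; rewrite /= lte_fin t0 -EFinB subr0.
Qed.

(** A single ball of radius [r < l / 2] packs. The packing condition is strict, so the radius
    [l / 2] itself is reached by continuity. *)
Lemma minkowski_ball (R : realType) (n : nat) (A : 'M[R]_n) (l : R) :
  A \in unitmx -> 0 < l ->
  (forall z : 'rV[int]_n, z != 0 -> l <= enorm (map_mx intr z *m A)) ->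
  omega R n * l ^+ n <= 2 ^+ n * `|\det A|.
Proof.
move=> uA l0 Al.
have lt_case (r : R) : 0 <= r -> r < l / 2 -> omega R n * r ^+ n <= `|\det A|.
  move=> r0 rl.
  have := @lattice_packing R n A unit (fun=> 0) (fun=> r ^+ 2) uA.
  rewrite big_const card_unit /= addr0 rpow_sqr// omegaE; apply.
  move=> [] [] z _ _ neq; rewrite sqrtr_sqr ger0_norm// subrr add0r.
  have /Al : z != 0 by apply/eqP => z0; apply: neq.
  lra.
rewrite -ler_pdivrMl ?exprn_gt0// mulrCA mulrC -exprVn -exprMn (mulrC _ l).
set h := l / 2; have h0 : 0 < h by rewrite divr_gt0.
rewrite leNgt (mulrC _ (omega R n)); apply/negP => detlt.
pose f (x : R) : R := omega R n * x ^+ n.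
have cf : f x @[x --> h] --> f h.
  by apply: cvgM; [exact: cvg_cst | exact: exprn_continuous].
have near_h : \forall x \near h, `|\det A| < f x by apply: cvgr_gt cf _ detlt.
have [e /= e0 he] : nbhs_ball h [set x | `|\det A| < f x] by apply/nbhs_ballP.
(* A nonnegative radius below [h], yet within [e] of it. *)
pose r := Num.max 0 (h - e / 2).
have r0 : 0 <= r by rewrite le_max lexx.
have rh : r < h by rewrite gt_max h0; lra.
have : f r <= `|\det A| by apply: lt_case.
apply/negP; rewrite -ltNge; apply: he.
rewrite /ball /= ger0_norm; last by lra.
have : h - e / 2 <= r by rewrite le_max lexx orbT.
lra.
Qed.

(** * Convex bodies and separation from a line *)

Lemma continuous_dotp (R : realType) (n : nat) (T : topologicalType)
    (f g : T -> 'rV[R]_n) :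
  continuous f -> continuous g -> continuous (fun x => dotp (f x) (g x)).
Proof.
move=> cf cg; rewrite /dotp.
apply: continuous_big => [|i _ x]; first exact: add_continuous.
apply: cvgM.
  by apply: (@continuous_comp _ _ _ f (fun M : 'rV[R]_n => M 0 i));
    [exact: cf | exact: coord_continuous].
by apply: (@continuous_comp _ _ _ g (fun M : 'rV[R]_n => M 0 i));
  [exact: cg | exact: coord_continuous].
Qed.

Lemma convex_setP (R : realType) (n : nat) (K : set 'rV[R]_n) (x y : 'rV[R]_n) (t : R) :
  convex_set K -> K x -> K y -> 0 <= t -> t <= 1 ->
  K (t *: x + (1 - t) *: y).
Proof.
move=> cK /mem_set Kx /mem_set Ky t0 t1.
by have /set_mem := cK _ _ (Itv01 t0 t1) Kx Ky.
Qed.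

Lemma interior_continuous (R : realType) (n : nat) (K : set 'rV[R]_n)
    (f : 'rV[R]_n -> 'rV[R]_n) (x : 'rV[R]_n) :
  continuous f -> interior K (f x) -> interior (f @^-1` K) x.
Proof. by move=> cf Kx; apply: cf. Qed.

(** The homothety of centre [x] and ratio [t] maps [K] into itself and is a homeomorphism; [f] is
    its inverse. *)
Lemma interior_convex (R : realType) (n : nat) (K : set 'rV[R]_n)
    (x z : 'rV[R]_n) (t : R) :
  convex_set K -> K x -> interior K z -> 0 < t -> t <= 1 ->
  interior K (t *: z + (1 - t) *: x).
Proof.
move=> cK Kx Kz t0 t1.
pose f (w : 'rV[R]_n) := t^-1 *: (w - (1 - t) *: x).
have cf : continuous f.
  by move=> w; exact: cvgZ (cvg_cst _) (cvgB cvg_id (cvg_cst _)).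
have : interior (f @^-1` K) (t *: z + (1 - t) *: x).
  apply: interior_continuous cf _.
  by rewrite /f addrK scalerA mulVf ?gt_eqF// scale1r.
apply: interiorS => w /= Kfw.
have -> : w = t *: f w + (1 - t) *: x.
  by rewrite /f scalerA mulfV ?gt_eqF// scale1r subrK.
exact: convex_setP (ltW t0) t1.
Qed.

(** From an interior point a small step along [u] stays in [K] and increases [dotp u]. *)
Lemma interior_support_lt (R : realType) (n : nat) (K : set 'rV[R]_n)
    (u z : 'rV[R]_n) (c : R) :
  u != 0 -> (forall x, K x -> dotp u x <= c) -> interior K z -> dotp u z < c.
Proof.
move=> u0 Kc Kz.
pose f (e : R) := z + e *: u.
have cf : continuous f.
  by move=> e; exact: cvgD (cvg_cst _) (cvgZ cvg_id (cvg_cst _)).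
have : nbhs (0 : R) (f @^-1` K).
  by apply: cf; rewrite /f scale0r addr0.
move=> /nbhs_ballP[e /= e0 he].
have /Kc : K (f (e / 2)).
  apply: he; rewrite /ball /= sub0r normrN gtr0_norm ?divr_gt0//; lra.
rewrite /f dotpDr dotpZr; apply: lt_le_trans.
by rewrite ltrDl mulr_gt0 ?divr_gt0// -enorm_sqr exprn_gt0 ?enorm_gt0.
Qed.

(* The point [y + e (y - x0)] lies outside the cylinder [K + R d]; [v] is the
   direction from its nearest point in that cylinder. *)
Lemma almost_separate_line (R : realType) (n : nat) (K : set 'rV[R]_n)
    (x0 y d : 'rV[R]_n) (eps : R) :
  compact K -> convex_set K -> interior K x0 -> d != 0 ->
  (forall t, ~ interior K (y + t *: d)) -> 0 < eps ->
  exists v, [/\ dotp v v = 1, dotp v d = 0 &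
    forall x, K x -> dotp v (x - y) <= eps].
Proof.
move=> Kcomp Kconv Kx0 d0 Kline eps0.
have Kx0' : K x0 by apply: interior_subset.
(* Chosen so that [e |y - x0| <= eps]; the added 1 keeps the denominator positive. *)
pose e := eps / (enorm (y - x0) + 1).
have yx0 : 0 < enorm (y - x0) + 1 by have := enorm_ge0 (y - x0); lra.
have e0 : 0 < e by rewrite divr_gt0.
pose z : 'rV[R]_n := y + e *: (y - x0).
(* As [y = (z + e x0) / (1 + e)], a representation [z = x + s d] would put a proper combination of
   [x] and the interior point [x0] on the line. *)
have zK x s : K x -> z <> x + s *: d.
  move=> Kx zE; apply: (Kline (- (s / (1 + e)))).
  have e1 : 1 + e != 0 by rewrite gt_eqF// addr_gt0.
  have -> : y + - (s / (1 + e)) *: d =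
      (e / (1 + e)) *: x0 + (1 - e / (1 + e)) *: x.
    have -> : x = z - s *: d by rewrite zE addrK.
    apply/rowP => i; rewrite /z !mxE; field.
    exact: e1.
  apply: interior_convex => //; first by rewrite divr_gt0// addr_gt0.
  by rewrite ler_pdivrMr ?addr_gt0//; lra.
have dd : dotp d d != 0 by rewrite dotp_eq0.
(* Orthogonal projection along [d], which turns distance to the cylinder into distance to the
   compact set [P K]. *)
pose P (w : 'rV[R]_n) : 'rV[R]_n := w - (dotp w d / dotp d d) *: d.
have cP : continuous P.
  have cd : continuous (fun w : 'rV[R]_n => dotp w d).
    by apply: continuous_dotp => x; [exact: cvg_id | exact: cst_continuous].
  move=> w.
  exact: cvgB cvg_id (cvgZ (cvgM (cd w) (cvg_cst _)) (cvg_cst _)).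
have PB w w' : P (w - w') = P w - P w'.
  by apply/rowP => i; rewrite /P dotpBl !mxE; ring.
have Pd w : dotp (P w) d = 0.
  by rewrite /P dotpBl dotpZl divfK// subrr.
have PZ a w : P (a *: w) = a *: P w.
  by rewrite /P dotpZl scalerBr scalerA mulrA.
have Pdot w w' : dotp (P w) (P w') = dotp (P w) w'.
  by rewrite {2}/P dotpBr dotpZr Pd mulr0 subr0.
have P0 w : P w = 0 -> w = (dotp w d / dotp d d) *: d by move/subr0_eq.
clearbody P.
pose f (x : 'rV[R]_n) := dotp (P (z - x)) (P (z - x)).
have cf : continuous f.
  have cPz : continuous (fun x : 'rV[R]_n => P (z - x)).
    move=> x; apply: (@continuous_comp _ _ _ (fun x : 'rV[R]_n => z - x) P); last exact: cP.
    exact: cvgB (cvg_cst _) cvg_id.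
  exact: continuous_dotp.
have [x1 /set_mem Kx1 x1min] := EVT_min_rV (ex_intro _ _ Kx0') Kcomp
  (continuous_subspaceT cf).
pose u := P (z - x1).
have u0 : u != 0.
  apply/eqP => u0; apply: (zK x1 (dotp (z - x1) d / dotp d d) Kx1).
  by rewrite -P0// addrC subrK.
(* Moving from [x1] towards [x] by a fraction [t] changes [f] by [t^2 b - 2 t a], which is negative
   for [t = a / (a + b)] if [a > 0]. *)
have ux1 x : K x -> dotp u (x - x1) <= 0.
  move=> Kx; rewrite leNgt; apply/negP => ux.
  pose b := dotp (P (x - x1)) (P (x - x1)).
  have b0 : 0 <= b by apply: dotp_ge0.
  pose a := dotp u (x - x1).
  pose t := a / (a + b).
  have ab : 0 < a + b by rewrite ltr_pwDl.
  have t0 : 0 < t by rewrite divr_gt0.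
  have t1 : t <= 1 by rewrite ler_pdivrMr// mul1r lerDl.
  have := x1min _ (mem_set (convex_setP Kconv Kx Kx1 (ltW t0) t1)).
  rewrite /f -/u.
  have -> : z - (t *: x + (1 - t) *: x1) = (z - x1) - t *: (x - x1).
    by apply/rowP => i; rewrite !mxE; ring.
  rewrite PB PZ -/u dotpBl !dotpBr !dotpZl !dotpZr (dotpC _ u) -/b.
  rewrite [dotp u (P (x - x1))]Pdot -/a.
  apply/negP; rewrite -ltNge.
  have : t * (t * b) < t * a.
    by rewrite ltr_pM2l// /t mulrAC ltr_pdivrMr// ltr_pM2l// ltrDr.
  by have := mulr_gt0 t0 ux; rewrite -/a; lra.
exists ((enorm u)^-1 *: u).
have un : enorm u != 0 by rewrite gt_eqF// enorm_gt0.
split.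
- by rewrite dotpZl dotpZr -enorm_sqr; field.
- by rewrite dotpZl Pd mulr0.
move=> x Kx; rewrite dotpZl.
have : dotp u (x - y) <= e * dotp u (y - x0).
  have := ux1 x Kx.
  have : 0 <= dotp u (z - x1) by rewrite -Pdot dotp_ge0.
  by rewrite /z !dotpBr dotpDr dotpZr dotpBr; lra.
move=> uxy; rewrite mulrC ler_pdivrMr ?enorm_gt0//.
apply: le_trans uxy _.
have := le_trans (ler_norm _) (cauchy_schwarz u (y - x0)) => ucs.
apply: (@le_trans _ _ (e * (enorm u * (enorm (y - x0) + 1)))).
  rewrite ler_pM2l//; apply: le_trans ucs _.
  by rewrite ler_wpM2l ?enorm_ge0// lerDl.
by rewrite /e mulrCA divfK ?gt_eqF// mulrC.
Qed.

(** Almost separating unit vectors for [eps = 1 / (k + 1)] have a cluster point on the compact unit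
    sphere, and the closed conditions pass to it. *)
Lemma separate_line (R : realType) (n : nat) (K : set 'rV[R]_n)
    (x0 y d : 'rV[R]_n) :
  compact K -> convex_set K -> interior K x0 -> d != 0 ->
  (forall t, ~ interior K (y + t *: d)) ->
  exists w, [/\ w != 0, dotp w d = 0 & forall x, K x -> dotp w x <= dotp w y].
Proof.
move=> Kcomp Kconv Kx0 d0 Kline.
have [v vP] := choice (fun k : nat => almost_separate_line Kcomp Kconv Kx0 d0
  Kline (ltac:(by rewrite invr_gt0 ltr0n) : 0 < k.+1%:R^-1 :> R)).
pose U := [set w : 'rV[R]_n | dotp w w = 1].
have cdot (a : 'rV[R]_n) : continuous (fun w => dotp w a).
  by apply: continuous_dotp => x; [exact: cvg_id | exact: cst_continuous].
have closed_dot (f : 'rV[R]_n -> R) (A : set R) :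
    continuous f -> closed A -> closed (f @^-1` A).
  by move=> cf; apply: closed_comp => w _; apply: cf.
have Ucomp : compact U.
  apply: bounded_closed_compact.
    exists 1; split=> // M M1 w w1; apply: le_trans (ltW M1).
    rewrite [leLHS]/Num.norm /= mx_normrE; apply/bigmax_leP; split=> //= -[i j] _ /=.
    rewrite ord1 -(@ler_pXn2r _ 2)// ?nnegrE// real_normK ?num_real// expr1n.
    rewrite -[leRHS]w1 /dotp (bigD1 j)//= -expr2 lerDl sumr_ge0// => k _.
    by rewrite -expr2 sqr_ge0.
  apply: (closed_dot (fun w => dotp w w) [set r | r = 1]); last exact: closed_eq.
  by apply: continuous_dotp => x; exact: cvg_id.
have [w [Uw cw]] : U `&` cluster (v @ \oo) !=set0.
  by apply: Ucomp; exists 0%N => //= k _; case: (vP k).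
have cl (A : set 'rV[R]_n) : closed A -> (\forall k \near \oo, A (v k)) -> A w.
  move=> Acl Av; apply: Acl => B Bw.
  exact: cw.
exists w; split.
- by rewrite -dotp_eq0 (_ : dotp w w = 1) ?oner_eq0.
- apply: (cl _ (closed_dot _ [set r | r = 0] (cdot d) (@closed_eq _ _))).
  by exists 0%N => //= k _; case: (vP k).
move=> x Kx; rewrite -subr_le0 -dotpBr leNgt; apply/negP => wx.
(* If this value were positive, [1 / (k + 1)] would eventually drop below half of it, and the half
   would bound the limit. *)
have : dotp w (x - y) <= dotp w (x - y) / 2.
  apply: (cl _ (closed_dot _ [set r | r <= dotp w (x - y) / 2] (cdot (x - y))
    (@closed_le _ _))).
  have wx2 : 0 < dotp w (x - y) / 2 by rewrite divr_gt0.
  near=> k; have [_ _ /(_ x Kx) /= vk] := vP k; apply: le_trans vk (ltW _).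
  by near: k; apply: (near_infty_natSinv_lt (PosNum wx2)).
by lra.
Unshelve. all: by end_near.
Qed.

(** * Illumination by vertices and translation *)

(** On the segment [dotp u] is at least [dotp u y], while it is smaller on the interior. If the line
    missed the interior, the separating hyperplane would contain [s], unlike the one given by
    [u]. *)
Lemma illuminates_point_support (R : realType) (n : nat) (K : set 'rV[R]_n)
    (y s u : 'rV[R]_n) :
  convex_body K -> (exists! H, support_hyperplane K y H) ->
  u != 0 -> (forall x, K x -> dotp u x <= dotp u y) -> dotp u y < dotp u s ->
  illuminates_point K s y.
Proof.
move=> [Kcomp Kconv [x0 Kx0]] [H [_ Huniq]] u0 Ku us.
have sy : s != y by apply/eqP => sy; rewrite sy ltxx in us.
split=> //.
  apply/seteqP; split=> // z [[t]]; rewrite /= in_itv/= => /andP[t0 t1] <- Kz.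
  have := interior_support_lt u0 Ku Kz.
  rewrite dotpDr dotpZr dotpBr; nra.
apply: contrapT => line0.
have [|t Kt|w [w0 wd Kw]] := @separate_line R n K x0 y (y - s) Kcomp Kconv Kx0.
- by rewrite subr_eq0 eq_sym.
- apply: line0; exists (y + t *: (y - s)); split=> //.
  exists (1 + t) => //.
  by rewrite scalerDl scale1r addrA addrCA addrN addr0.
have supp (v : 'rV[R]_n) : v != 0 -> (forall x, K x -> dotp v x <= dotp v y) ->
    H = [set x | dotp v x = dotp v y].
  by move=> v0 Kv; apply: Huniq; exists v, (dotp v y).
have /(congr1 (@^~ s)) /= E : [set x | dotp w x = dotp w y] =
    [set x | dotp u x = dotp u y] by rewrite -(supp u)// -(supp w).
have : dotp u s = dotp u y.
  by rewrite -E; apply/esym/eqP; rewrite -subr_eq0 -dotpBr wd.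
by move=> uE; rewrite uE ltxx in us.
Qed.

(** If no vertex were strictly beyond the support hyperplane at [y], the positive weights of [y]
    would force every vertex onto it, which the third hypothesis excludes. *)
Lemma illuminated_by_simplex (R : realType) (n : nat) (K : set 'rV[R]_n)
    (I : finType) (s : I -> 'rV[R]_n) :
  convex_body K -> smooth_boundary K ->
  (forall u a, (forall i, dotp u (s i) = a) -> u = 0) ->
  (forall y, K y -> exists lam : I -> R, [/\ forall i, 0 < lam i,
     \sum_i lam i = 1 & y = \sum_i lam i *: s i]) ->
  forall y, bdry K y -> exists i, illuminates_point K (s i) y.
Proof.
move=> Kbody Ksmooth span_s Kin y By.
have Ky : K y.
  have [Kcomp _ _] := Kbody.
  by case: By => + _; rewrite -(closure_id _).1//; apply: compact_closed;
    [exact: norm_hausdorff |].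
have Huniq := Ksmooth y By.
have [H [[u [c [u0 HE Hy Ku]]] _]] := Huniq.
have uy : dotp u y = c by rewrite HE in Hy.
have [i ui] : exists i, dotp u y < dotp u (s i).
  apply: contrapT => noi.
  have sle i : dotp u (s i) <= c.
    by rewrite leNgt; apply/negP => ?; apply: noi; exists i; rewrite uy.
  have [lam [lam0 lam1 yE]] := Kin y Ky.
  have : \sum_i lam i * (c - dotp u (s i)) = 0.
    under eq_bigr do rewrite mulrBr.
    rewrite sumrB -mulr_suml lam1 mul1r -{1}uy {1}yE dotpC dotp_suml.
    rewrite -sumrB big1// => i _.
    by rewrite dotpZl dotpC subrr.
  move/eqP; rewrite psumr_eq0 => [/allP h|i _]; last first.
    by apply: mulr_ge0; [exact: ltW | rewrite subr_ge0].
  suff u00 : u = 0 by rewrite u00 eqxx in u0.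
  apply: (span_s _ c) => i.
  have := h i (mem_index_enum i); rewrite mulf_eq0 gt_eqF//= subr_eq0.
  by move=> /eqP.
exists i; apply: illuminates_point_support ui => // x Kx.
by rewrite uy; apply: Ku.
Qed.

Lemma interior_translate (R : realType) (n : nat) (v z : 'rV[R]_n)
    (K : set 'rV[R]_n) :
  interior (translate v K) z <-> interior K (z - v).
Proof.
have cD (a : 'rV[R]_n) : continuous (fun x : 'rV[R]_n => x + a).
  by move=> x; exact: cvgD cvg_id (cvg_cst _).
split=> Kz.
  have : interior ((fun x => x + v) @^-1` translate v K) (z - v).
    by apply: interior_continuous (cD v) _; rewrite subrK.
  apply: interiorS => x [x' Kx' /addIr <-//].
have : interior ((fun x => x - v) @^-1` K) z.
  exact: interior_continuous (cD (- v)) _.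
by apply: interiorS => x Kx; exists (x - v) => //; rewrite subrK.
Qed.

Lemma bdry_translate (R : realType) (n : nat) (v z : 'rV[R]_n)
    (K : set 'rV[R]_n) :
  bdry (translate v K) z -> bdry K (z - v).
Proof.
move=> [cz iz]; split; last by move/interior_translate.
move=> B Bz.
have : nbhs z ((fun x => x - v) @^-1` B).
  have cD : continuous (fun x : 'rV[R]_n => x - v).
    by move=> x; exact: cvgB cvg_id (cvg_cst _).
  exact: cD.
by move=> /cz[_ [[x Kx <-]]] /=; rewrite addrK => Bx; exists x.
Qed.

Lemma illuminates_point_translate (R : realType) (n : nat) (v x y : 'rV[R]_n)
    (K : set 'rV[R]_n) :
  illuminates_point K (x - v) (y - v) -> illuminates_point (translate v K) x y.
Proof.
have pt t : x + t *: (y - x) - v = x - v + t *: (y - v - (x - v)).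
  by rewrite opprB addrA subrK addrAC.
move=> [xy seg lin]; split.
- by apply: contra xy => /eqP ->.
- apply/seteqP; split=> // _ [[t tt <-] /interior_translate].
  rewrite pt => Kt; move/seteqP : seg => [/(_ (x - v + t *: (y - v - (x - v))))].
  by move=> h _; apply: h; split=> //; exists t.
- case: lin => _ [[t tt <-] Kt]; exists (x + t *: (y - x)).
  split; first by exists t.
  by apply/interior_translate; rewrite pt.
Qed.

Lemma enorm_le_diameter (R : realType) (n : nat) (K : set 'rV[R]_n)
    (x y : 'rV[R]_n) :
  compact K -> K x -> K y -> enorm (x - y) <= diameter K.
Proof.
move=> Kcomp Kx Ky; apply: ub_le_sup; last by exists x => //; exists y.
(* The supremum is an upper bound only for a bounded set; twice the largest distance from [x] bounds
   all distances. *)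
pose f (z : 'rV[R]_n) := dotp (z - x) (z - x).
have cf : continuous f.
  by apply: continuous_dotp => z; exact: cvgB cvg_id (cvg_cst _).
have [c Kc cmax] := EVT_max_rV (ex_intro _ _ Kx) Kcomp (continuous_subspaceT cf).
have le_c z : K z -> enorm (z - x) <= Num.sqrt (f c).
  by move=> Kz; apply: ler_wsqrtr; apply/cmax/mem_set.
exists (Num.sqrt (f c) + Num.sqrt (f c)) => _ [z Kz] [w Kw] <-.
have -> : z - w = (z - x) - (w - x) by rewrite opprB addrA subrK.
apply: le_trans (enormD _ _) _; rewrite enormN.
by apply: lerD; apply: le_c.
Qed.

(** * The constant, lattice vectors and the dilated simplex *)

(** With [n = m + 1], this combines [sqrt (2 (n + 1)) <= 2 sqrt n], [n <= 2^(n-1)] and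
    [2n - 1 <= n^2]. *)
Lemma Cn_ge (R : realType) (m : nat) : (2 * m + 1)%:R <= Cn R m.+1.
Proof.
pose N : R := m.+1%:R.
have N1 : 1 <= N by rewrite ler1n.
have s2 : Num.sqrt (2 * (N + 1)) <= 2 * Num.sqrt N.
  have -> : 2 * Num.sqrt N = Num.sqrt (2 ^+ 2 * N).
    by rewrite sqrtrM ?sqr_ge0// sqrtr_sqr ger0_norm.
  by apply: ler_wsqrtr; lra.
have s0 : 0 < Num.sqrt (2 * (N + 1)) by rewrite sqrtr_gt0; lra.
have sN : 0 < Num.sqrt N by rewrite sqrtr_gt0; lra.
have N2 : N <= 2 ^+ m by rewrite -natrX ler_nat ltn_expl.
rewrite /Cn -/N /= ler_pdivlMr//.
have -> : (2 * m + 1)%:R = 2 * N - 1 :> R.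
  by rewrite natrD natrM /N -natr1; lra.
apply: (@le_trans _ _ ((2 * N - 1) * (2 * Num.sqrt N))).
  by rewrite ler_wpM2l//; lra.
apply: (@le_trans _ _ (N * Num.sqrt N * (N + N))); last first.
  by rewrite ler_wpM2l ?lerD2l// mulr_ge0//; lra.
have : (2 * N - 1) * Num.sqrt N <= N * N * Num.sqrt N.
  by rewrite ler_wpM2r ?(ltW sN)//; have := sqr_ge0 (N - 1); lra.
lra.
Qed.

Lemma map_intr_inj (R : realType) (m n : nat) :
  injective (map_mx intr : 'M[int]_(m, n) -> 'M[R]_(m, n)).
Proof.
move=> x y /matrixP xy; apply/matrixP => i j.
by have := xy i j; rewrite !mxE => /intr_inj.
Qed.

Lemma lattice_int_comb (R : realType) (m n : nat) (L : set 'rV[R]_n)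
    (A : 'M[R]_(m, n)) (z : 'rV[int]_m) :
  full_rank_lattice L -> (forall i, L (row i A)) -> L (map_mx intr z *m A).
Proof.
move=> [B _ ->] LA.
have {}LA i : exists y : 'rV[int]_n, map_mx intr y *m B = row i A.
  by have [y _ yE] := LA i; exists y.
have [y yA] := choice LA.
have -> : A = map_mx intr (\matrix_i y i) *m B.
  apply/row_matrixP => i; rewrite -yA row_mul; congr (_ *m _).
  by apply/rowP => j; rewrite !mxE.
by exists (z *m \matrix_i y i) => //; rewrite map_mxM mulmxA.
Qed.

Lemma min_norm_le (R : realType) (n : nat) (L : set 'rV[R]_n) (x : 'rV[R]_n) :
  L x -> x != 0 -> min_norm L <= enorm x.
Proof.
move=> Lx x0; apply: ge_inf; last by exists x => //; split=> //; apply/eqP.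
by exists 0 => _ [y _ <-]; apply: enorm_ge0.
Qed.

(** Cauchy-Schwarz against the dual vector, whose norm is at most [l^m / |det A|], followed by the
    lower bound on [|det A|]. *)
Lemma dual_coord_le (R : realType) (m : nat) (A : 'M[R]_m.+1) (l : R)
    (x : 'rV[R]_m.+1) (i : 'I_m.+1) :
  A \in unitmx -> 0 < l -> (forall i, enorm (row i A) <= l) ->
  omega R m.+1 * l ^+ m.+1 <= 2 ^+ m.+1 * `|\det A| ->
  `|(x *m invmx A) 0 i| <= enorm x * (2 ^+ m.+1 / (omega R m.+1 * l)).
Proof.
move=> uA l0 Al mink.
have -> : (x *m invmx A) 0 i = dotp x (col i (invmx A))^T.
  by rewrite dotpE trmxK colE mulmxA -colE !mxE.
apply: le_trans (cauchy_schwarz _ _) _.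
apply: ler_wpM2l; first exact: enorm_ge0.
have w0 : 0 < omega R m.+1 by rewrite omegaE ball_volume_gt0.
rewrite ler_pdivlMr ?mulr_gt0//.
have det0 : 0 < `|\det A| by rewrite normr_gt0 -unitfE -unitmxE.
have dual := enorm_dual_le i uA Al.
rewrite -(ler_pM2l det0) mulrA.
apply: (@le_trans _ _ (l ^+ m * (omega R m.+1 * l))).
  by rewrite ler_pM2r// mulr_gt0.
by rewrite (mulrC `|_|); apply: le_trans mink; rewrite exprS; lra.
Qed.

(* The [k]-fold dilate of the simplex spanned by [0] and the rows of [A]. *)
Definition simplex_coord (m k : nat) (i : 'I_m.+2) : 'rV[int]_m.+1 :=
  if unlift ord0 i is Some j then k%:Z *: delta_mx 0 j else 0.

(** Integer coordinates make lattice membership an instance of [lattice_int_comb]. *)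
Definition simplex_vertex (R : realType) (m k : nat) (A : 'M[R]_m.+1)
    (i : 'I_m.+2) : 'rV[R]_m.+1 :=
  map_mx intr (simplex_coord k i) *m A.

Lemma simplex_vertex0 (R : realType) (m k : nat) (A : 'M[R]_m.+1) :
  simplex_vertex k A ord0 = 0.
Proof. by rewrite /simplex_vertex /simplex_coord unlift_none map_mx0 mul0mx. Qed.

Lemma simplex_vertexS (R : realType) (m k : nat) (A : 'M[R]_m.+1) (j : 'I_m.+1) :
  simplex_vertex k A (lift ord0 j) = k%:R *: row j A.
Proof.
rewrite /simplex_vertex /simplex_coord liftK map_mxZ map_delta_mx/= -scalemxAl.
by rewrite -rowE.
Qed.

Lemma simplex_vertex_inj (R : realType) (m k : nat) (A : 'M[R]_m.+1) :
  A \in unitmx -> (0 < k)%N -> injective (simplex_vertex k A).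
Proof.
move=> uA k0 i j /(can_inj (mulmxK uA)) /map_intr_inj.
rewrite /simplex_coord; case: unliftP => [i'|] -> ; case: unliftP => [j'|] -> //.
- move=> /rowP /(_ i'); rewrite !mxE !eqxx /= mulr1.
  case: eqVneq => [->//|_]; rewrite mulr0 => -[k00].
  by rewrite k00 in k0.
- by move=> /rowP /(_ i'); rewrite !mxE !eqxx /= mulr1 => -[k00]; rewrite k00 in k0.
- by move=> /rowP /(_ j'); rewrite !mxE !eqxx /= mulr1 => -[k00]; rewrite -k00 in k0.
Qed.

(** The source of the factor 2 in the theorem: every vertex is within [k l] of the vertex 0. *)
Lemma enorm_simplex_vertexB (R : realType) (m k : nat) (A : 'M[R]_m.+1) (l : R)
    (i j : 'I_m.+2) :
  0 <= l -> (forall i, enorm (row i A) <= l) ->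
  enorm (simplex_vertex k A i - simplex_vertex k A j) <= 2 * k%:R * l.
Proof.
move=> l0 Al.
have sl a : enorm (simplex_vertex k A a) <= k%:R * l.
  have [b ->|->] := unliftP ord0 a.
    by rewrite simplex_vertexS enormZ normr_nat ler_wpM2l.
  by rewrite simplex_vertex0 enorm0 mulr_ge0.
apply: le_trans (enormD _ _) _; rewrite enormN.
by have := sl i; have := sl j; lra.
Qed.

Lemma barycentric (R : realType) (m k : nat) (A : 'M[R]_m.+1) (b : 'rV[R]_m.+1) :
  (0 < k)%N -> (forall i, 0 < b 0 i) -> \sum_i b 0 i < k%:R ->
  exists lam : 'I_m.+2 -> R, [/\ forall i, 0 < lam i, \sum_i lam i = 1
    & b *m A = \sum_i lam i *: simplex_vertex k A i].
Proof.
move=> k0 b0 bk.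
have k0' : 0 < k%:R :> R by rewrite ltr0n.
exists (fun i => if unlift ord0 i is Some j then b 0 j / k%:R
  else 1 - (\sum_j b 0 j) / k%:R); split.
- move=> i; case: unliftP => [j _|_]; first by rewrite divr_gt0.
  by rewrite subr_gt0 ltr_pdivrMr// mul1r.
- rewrite big_ord_recl unlift_none; under [X in _ + X]eq_bigr do rewrite liftK.
  by rewrite -mulr_suml subrK.
- rewrite big_ord_recl simplex_vertex0 scaler0 add0r mulmx_sum_row.
  apply: eq_bigr => i _; rewrite liftK simplex_vertexS scalerA divfK//.
  by rewrite gt_eqF.
Qed.

Lemma translate_into_simplex (R : realType) (m k : nat) (A : 'M[R]_m.+1)
    (K : set 'rV[R]_m.+1) (M : R) :
  compact K -> K !=set0 -> A \in unitmx ->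
  (forall x y i, K x -> K y -> `|((x - y) *m invmx A) 0 i| <= M) ->
  (2 * m + 1)%:R * M < k%:R ->
  exists v : 'rV[R]_m.+1, forall x, K x -> exists lam : 'I_m.+2 -> R,
    [/\ forall i, 0 < lam i, \sum_i lam i = 1
      & x + v = \sum_i lam i *: simplex_vertex k A i].
Proof.
move=> Kcomp [x0 Kx0] uA KM Mk.
have M0 : 0 <= M by apply: le_trans (KM x0 x0 0 Kx0 Kx0).
have k0 : (0 < k)%N by rewrite -(ltr0n R); apply: le_lt_trans Mk; rewrite mulr_ge0.
pose f (x : 'rV[R]_m.+1) := dotp x (col 0 (invmx A))^T.
have fE x : f x = (x *m invmx A) 0 0.
  by rewrite /f dotpE trmxK colE mulmxA -colE !mxE.
have cf : continuous f.
  by apply: continuous_dotp => x; [exact: cvg_id | exact: cst_continuous].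
have [p /set_mem Kp pmin] := EVT_min_rV (ex_intro _ _ Kx0) Kcomp
  (continuous_subspaceT cf).
(* The [m + 1] margins [e] together use half of the slack [k - (2m + 1) M]. *)
pose e : R := (k%:R - (2 * m + 1)%:R * M) / (2 * m.+1%:R).
have e0 : 0 < e by rewrite divr_gt0 ?subr_gt0// mulr_gt0.
(* Relative to [p] the first coordinate is already nonnegative; the others may be as low as [-M]. *)
pose o : 'rV[R]_m.+1 := \row_i (if i == 0 then e else M + e).
exists (o *m A - p) => x Kx.
pose b := (x - p) *m invmx A + o.
have -> : x + (o *m A - p) = b *m A.
  by rewrite /b mulmxDl mulmxKV// addrCA addrC.
have bE i : b 0 i = ((x - p) *m invmx A) 0 i + o 0 i by rewrite [LHS]mxE.
have oE i : o 0 i = if i == 0 then e else M + e by rewrite mxE.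
have Kxp i : `|((x - p) *m invmx A) 0 i| <= M by apply: KM.
apply: barycentric => // [i|].
- rewrite bE oE; have [->|_] := eqVneq i 0.
    rewrite mulmxBl [X in X + e]mxE [X in _ + X + e]mxE -!fE.
    by have := pmin x (mem_set Kx); lra.
  by have := Kxp i; rewrite ler_norml => /andP[]; lra.
- apply: (@le_lt_trans _ _ (\sum_(i < m.+1) M + \sum_i o 0 i)).
    rewrite -big_split/=; apply: ler_sum => i _; rewrite bE lerD2r.
    exact: le_trans (ler_norm _) (Kxp i).
  have -> : \sum_i o 0 i = e + m%:R * (M + e).
    rewrite big_ord_recl oE eqxx; under eq_bigr do rewrite oE /=.
    by rewrite sumr_const card_ord mulr_natl.
  rewrite sumr_const card_ord -mulr_natl.
  have eE : 2 * m.+1%:R * e = k%:R - (2 * m + 1)%:R * M.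
    by rewrite /e mulrC divfK// mulf_neq0// ?pnatr_eq0.
  move: eE; rewrite natrD natrM -natr1.
  have : 0 < m.+1%:R * e by rewrite mulr_gt0.
  rewrite -natr1; lra.
Qed.

(** * Assembly of the bound *)

Theorem corollary1p3 (R : realType) (n : nat) (K L : set 'rV[R]_n) :
  (1 <= n)%N ->
  convex_body K -> smooth_boundary K ->
  full_rank_lattice L -> well_rounded L ->
  exists (S : set 'rV[R]_n) (v : 'rV[R]_n),
    [/\ S `<=` L,
        (S #= `I_n.+1)%card,
        illuminates S (translate v K)
      & illum_dist S (translate v K) <=
        2 * (Num.floor (2 ^+ n * Cn R n * diameter K
                          / (omega R n * min_norm L) + 1))%:~R * min_norm L].
Proof.
case: n K L => // m K L _ Kbody Ksmooth Llat [A Afree Amin].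
have [Kcomp Kconv [x0 Kx0]] := Kbody.
have {}Kx0 : K x0 by apply: interior_subset.
have uA : A \in unitmx by rewrite -row_free_unit.
set l := min_norm L in Amin *.
have Al i : enorm (row i A) = l by case: (Amin i).
have LA i : L (row i A) by case: (Amin i).
have l0 : 0 < l.
  rewrite -(Al 0) enorm_gt0; apply/eqP => r0.
  have : row 0 A *m invmx A = 0 by rewrite r0 mul0mx.
  rewrite -row_mul mulmxV// => /rowP /(_ 0).
  by rewrite !mxE => /eqP; rewrite oner_eq0.
(* The rows of [A] may span only a sublattice of [L], but its nonzero vectors still have norm at
   least [l]. *)
have mink : omega R m.+1 * l ^+ m.+1 <= 2 ^+ m.+1 * `|\det A|.
  apply: minkowski_ball => // z z0; apply: min_norm_le.
    exact: lattice_int_comb.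
  apply: contra z0 => /eqP zA0; apply/eqP.
  apply: (@map_intr_inj R); rewrite map_mx0.
  by apply: (can_inj (mulmxK uA)); rewrite mul0mx.
set D := diameter K; set X := _ + 1.
have w0 : 0 < omega R m.+1 by rewrite omegaE ball_volume_gt0.
have D0 : 0 <= D.
  by apply: le_trans (enorm_ge0 (x0 - x0)) (enorm_le_diameter Kcomp Kx0 Kx0).
have wl0 : 0 < omega R m.+1 * l by rewrite mulr_gt0.
have Cn0 : 0 <= Cn R m.+1 by apply: le_trans (Cn_ge R m).
have X1 : 1 <= X.
  by rewrite lerDr divr_ge0 ?(ltW wl0)// !mulr_ge0// exprn_ge0.
pose k := `|Num.floor X|%N.
have kE : (Num.floor X)%:~R = k%:R :> R.
  by rewrite /k -[in LHS](gez0_abs (_ : 0 <= Num.floor X)) ?floor_ge0 ?(le_trans _ X1).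
(* The 1 added before taking the integer part gives the strict inequality [C_n M < k] needed to fit
   [K] inside the simplex. *)
have Xk : X - 1 < k%:R.
  by rewrite -kE ltrBlDr -[X in _ + X](rmorph1 (intr : int -> R)) -rmorphD floorD1_gt.
have Al' i : enorm (row i A) <= l by rewrite Al.
pose M := D * (2 ^+ m.+1 / (omega R m.+1 * l)).
have [||v vK] := @translate_into_simplex R m k A K M Kcomp (ex_intro _ _ Kx0) uA.
- move=> x y i Kx Ky; apply: le_trans (dual_coord_le (x - y) i uA l0 Al' mink) _.
  by rewrite ler_wpM2r ?enorm_le_diameter// divr_ge0 ?(ltW wl0)// exprn_ge0.
- apply: le_lt_trans Xk; rewrite /X addrK.
  have -> : 2 ^+ m.+1 * Cn R m.+1 * D / (omega R m.+1 * l) = Cn R m.+1 * M.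
    by rewrite /M; ring.
  by rewrite ler_wpM2r ?Cn_ge// mulr_ge0// divr_ge0 ?(ltW wl0)// exprn_ge0.
pose s := simplex_vertex k A.
have k0 : (0 < k)%N by rewrite -(ltr0n R) -kE ltr0z floor_gt0.
exists [set s (inord j) | j in `I_m.+2], v; split.
- by move=> _ [j _ <-]; apply: lattice_int_comb.
- apply: inj_card_eq => i j; rewrite !inE /= => im jm.
  by move=> /(simplex_vertex_inj uA k0)/(congr1 (@nat_of_ord m.+2)); rewrite !inordK.
- move=> y /bdry_translate By.
  (* The vertices are shifted by [-v] rather than the body by [v], so that the smoothness of [K]
     applies directly. *)
  have [||i ill] := @illuminated_by_simplex R m.+1 K _ (fun i => s i - v) Kbody Ksmooth _ _ _ By.
  + move=> u a ua; have u_row j : dotp u (row j A) = 0.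
      have := ua (lift ord0 j); rewrite -(ua ord0) !dotpBr => /addIr.
      rewrite /s simplex_vertex0 simplex_vertexS dotp0r dotpZr => /eqP.
      by rewrite mulf_eq0 pnatr_eq0 -leqn0 leqNgt k0 => /eqP.
    have : u *m A^T = 0.
      apply/rowP => j; rewrite [LHS]mxE [RHS]mxE -[RHS](u_row j) /dotp.
      by apply: eq_bigr => i _; rewrite !mxE.
    by move/(canRL (mulmxK _)) => ->; rewrite ?mul0mx// unitmx_tr.
  + move=> x Kx; have [lam [lam0 lam1 xE]] := vK x Kx.
    exists lam; split=> //; under eq_bigr do rewrite scalerBr.
    by rewrite sumrB -scaler_suml lam1 scale1r -xE addrK.
  exists (s i); last exact: illuminates_point_translate.
  by exists i => //=; rewrite ?inord_val.
rewrite kE; apply: ge_sup.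
  exists (enorm (s (inord 0) - (x0 + v))), (s (inord 0)); first by exists 0%N.
  by exists (x0 + v) => //; exists x0.
move=> _ [_ [j _ <-]] [_ [x Kx <-]] <-.
have [lam [lam0 lam1 ->]] := vK x Kx.
(* A point of the translate is a convex combination of vertices, so its distance to a vertex is at
   most the largest distance between vertices. *)
have -> : s (inord j) - \sum_i lam i *: simplex_vertex k A i =
    \sum_i lam i *: (s (inord j) - s i).
  by under [RHS]eq_bigr do rewrite scalerBr;
    rewrite sumrB -scaler_suml lam1 scale1r.
apply: le_trans (enorm_sum _) _.
rewrite -[leRHS]mul1r -[X in _ <= X * _]lam1 mulr_suml; apply: ler_sum => i _.
rewrite enormZ gtr0_norm//; apply: ler_wpM2l; first exact: ltW.
exact: (enorm_simplex_vertexB k (inord j) i (ltW l0) Al').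
Qed.
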